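(* Let $P$ be a poset, $\mathbf{k}$ a field, and $\varphi:P\times P\to P$ an order-preserving map. For every persistence module $M:\mathbf{P}\to\mathbf{Vect}_{\mathbf{k}}$, the functor $M\otimes_\varphi-$ is left adjoint to the functor $\mathscr{H}om^{\varphi}(M,-)$; that is, there are natural bijections $$\mathrm{Hom}_{\mathbf{k}^{\mathbf{P}}}(M\otimes_\varphi N,L)\approx \mathrm{Hom}_{\mathbf{k}^{\mathbf{P}}}(N,\mathscr{H}om^{\varphi}(M,L))$$ for any persistence modules $M,N,L$. Similarly, the functor $-\otimes_\varphi M$ is left adjoint to the functor ${}^{\varphi}\mathscr{H}om(M,-)$; that is, there are natural bijections $$\mathrm{Hom}_{\mathbf{k}^{\mathbf{P}}}(N\otimes_\varphi M,L)\approx \mathrm{Hom}_{\mathbf{k}^{\mathbf{P}}}(N,{}^{\varphi}\mathscr{H}om(M,L))$$ for any persistence modules $M,N,L$.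
   Context: A poset $P$ is viewed as a category $\mathbf{P}$ with a unique morphism $p\to q$ iff $p\le q$. A persistence module (indexed by $P$) is a functor $M:\mathbf{P}\to\mathbf{Vect}_{\mathbf{k}}$; with natural transformations they form the abelian category $\mathbf{k}^{\mathbf{P}}$. $P\times P$ has the product order, and $\pi_1,\pi_2:P\times P\to P$ are the projections. For an order-preserving $f:P\to Q$: $(f^{-1}G)_p=G_{f(p)}$ for $G\in\mathbf{k}^{\mathbf{Q}}$; $(f_*F)_q=\lim_{q\le f(p)}F_p$ and $(f_\dagger F)_q=\operatorname{colim}_{f(p)\le q}F_p$ for $F\in\mathbf{k}^{\mathbf{P}}$, with induced structure maps. Pointwise tensor product: $(M\otimes_{\mathbf{P}}N)_p=M_p\otimes_{\mathbf{k}}N_p$. Sheaf internal hom: $\mathscr{H}om_{\mathbf{P}}(M,N)_p=\mathrm{Hom}_{\mathbf{k}^{\mathbf{U}_p}}(M|_{\mathbf{U}_p},N|_{\mathbf{U}_p})$ where $U_p=\{q\in P: p\le q\}$, with structure maps given by restriction of natural transformations. The $\varphi$-tensor product is $M\otimes_\varphi N=\varphi_\dagger(\pi_1^{-1}M\otimes_{\mathbf{P}\times\mathbf{P}}\pi_2^{-1}N)$, so $(M\otimes_\varphi N)_p=\operatorname{colim}_{\varphi(a,b)\le p}M_a\otimes_{\mathbf{k}}N_b$. The $\varphi$-internal homs are $$\mathscr{H}om^{\varphi}(M,N)=\pi_{2*}\mathscr{H}om_{\mathbf{P}\times\mathbf{P}}(\pi_1^{-1}M,\varphi^{-1}N),\qquad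 {}^{\varphi}\mathscr{H}om(M,N)=\pi_{1*}\mathscr{H}om_{\mathbf{P}\times\mathbf{P}}(\pi_2^{-1}M,\varphi^{-1}N).$$ *)

(* Defs.v *)
From HB Require Import structures.
From mathcomp Require Import all_boot all_order all_algebra.
From mathcomp Require Import boolp.
From mathcomp.multinomials Require Import freeg.

Set Implicit Arguments.
Unset Strict Implicit.
Unset Printing Implicit Defensive.

Import Order.TTheory GRing.Theory.
Local Open Scope ring_scope.
Local Open Scope quotient_scope.

Section Linear.
Variables (k : fieldType) (U V : lmodType k).

Definition mklin (f : U -> V) (f_lin : linear f) : {linear U -> V} :=
  HB.pack f (GRing.isLinear.Build k U V *:%R f f_lin).

Lemma linear_ext (f g : {linear U -> V}) : f =1 g -> f = g.
Proof.
case: f => f [[f1] [f2]]; case: g => g [[g1] [g2]] /= /funext fg.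
by subst g; rewrite (Prop_irrelevance g1 f1) (Prop_irrelevance g2 f2).
Qed.

End Linear.

Section VQuot.
Variables (k : fieldType) (V : lmodType k) (S : V -> Prop).

Inductive span : V -> Prop :=
| span0 : span 0
| span_gen v : S v -> span v
| span_lin a u v : span u -> span v -> span (a *: u + v).

Definition span_pred : {pred V} := fun v => `[< span v >].

Lemma span_zmod_closed : zmod_closed span_pred.
Proof.
split=> [|u v /asboolP su /asboolP sv]; first exact/asboolP/span0.
by apply/asboolP; rewrite addrC -scaleN1r; exact: span_lin.
Qed.
HB.instance Definition _ := GRing.isZmodClosed.Build V span_pred span_zmod_closed.

Lemma span_scale a v : v \in span_pred -> a *: v \in span_pred.
Proof.
by move=> /asboolP sv; apply/asboolP; rewrite -[_ *: _]addr0;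
  apply: span_lin => //; exact: span0.
Qed.

(* V / span S; MathComp's [Quotient.quot] only provides the additive group. *)
Definition vquot : Type := Quotient.quot span_pred.
HB.instance Definition _ := GRing.Zmodule.on vquot.

Definition vpi (v : V) : vquot := \pi_(Quotient.quot span_pred) v.
Definition vrepr (x : vquot) : V := repr (x : Quotient.quot span_pred).

Lemma vreprK : cancel vrepr vpi.
Proof. exact: reprK. Qed.

Lemma vpi_eq u v : (vpi u = vpi v) <-> span (u - v).
Proof.
split=> [e|e]; first by apply/asboolP; move/eqP: e; rewrite -Quotient.idealrBE.
by apply/eqP; rewrite -Quotient.idealrBE; apply/asboolP.
Qed.

Lemma vpiB : {morph vpi : u v / u - v}.
Proof. by move=> u v; rewrite /vpi !piE. Qed.

Lemma vpiD : {morph vpi : u v / u + v}.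
Proof. by move=> u v; rewrite /vpi !piE. Qed.

Definition vscale (a : k) (x : vquot) : vquot := vpi (a *: vrepr x).

Lemma vpi_scale a v : vpi (a *: v) = vscale a (vpi v).
Proof.
apply/vpi_eq; rewrite -scalerBr; apply/asboolP/span_scale/asboolP.
by apply/vpi_eq; rewrite vreprK.
Qed.

Fact vscaleA a b x : vscale a (vscale b x) = vscale (a * b) x.
Proof. by rewrite -[x]vreprK -!vpi_scale scalerA. Qed.
Fact vscale1 : left_id 1 vscale.
Proof. by move=> x; rewrite -[x]vreprK -vpi_scale scale1r. Qed.
Fact vscaleDr : right_distributive vscale +%R.
Proof.
by move=> a x y; rewrite -[x]vreprK -[y]vreprK -vpiD -!vpi_scale -vpiD scalerDr.
Qed.
Fact vscaleDl x : {morph vscale^~ x : a b / a + b}.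
Proof. by move=> a b; rewrite -[x]vreprK -!vpi_scale -vpiD scalerDl. Qed.

HB.instance Definition _ := GRing.Zmodule_isLmodule.Build k vquot
  vscaleA vscale1 vscaleDr vscaleDl.

Fact vpi_is_linear : linear vpi.
Proof. by move=> a u v; rewrite vpiD vpi_scale. Qed.
HB.instance Definition _ := GRing.isLinear.Build k V vquot *:%R vpi vpi_is_linear.

Section Lift.
Variables (W : lmodType k) (g : {linear V -> W}).
Hypothesis gS : forall v, S v -> g v = 0.

Lemma span_ker v : span v -> g v = 0.
Proof.
elim=> [|u /gS//|a u w _ gu _ gw]; first exact: linear0.
by rewrite linearP gu gw scaler0 addr0.
Qed.

Definition vlift_fun (x : vquot) : W := g (vrepr x).

Lemma vlift_funE v : vlift_fun (vpi v) = g v.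
Proof.
apply/eqP; rewrite -subr_eq0 -linearB; apply/eqP/span_ker.
by apply/vpi_eq; rewrite vreprK.
Qed.

Fact vlift_is_linear : linear vlift_fun.
Proof.
move=> a x y; rewrite -[x]vreprK -[y]vreprK.
by rewrite -linearP !vlift_funE linearP.
Qed.

Definition vlift : {linear vquot -> W} := mklin vlift_is_linear.

Lemma vliftE v : vlift (vpi v) = g v.
Proof. exact: vlift_funE. Qed.

End Lift.
End VQuot.

Section Presentation.
Variables (k : fieldType) (X : choiceType).

Definition fgen (x : X) : {freeg X / k} := << x >>.

Section FreeLift.
Variables (W : lmodType k) (g : X -> W).

Fact fglift_is_linear : linear (fglift g : {freeg X / k} -> W).
Proof.
have fgD (D E : {freeg X / k}) : fglift g (D + E) = fglift g D + fglift g E.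
  by have B := lift_is_additive g;
    rewrite -[E in LHS]opprK -[- E]sub0r !B -{1}(subrr 0) B subrr sub0r opprK.
have fg0 : fglift g (0 : {freeg X / k}) = 0.
  by rewrite -(subrr 0) lift_is_additive subrr.
move=> a D E; rewrite fgD; congr (_ + _).
have fgsum (I : Type) (r : seq I) (F : I -> {freeg X / k}) :
    fglift g (\sum_(i <- r) F i) = \sum_(i <- r) fglift g (F i).
  by apply: (big_morph _ fgD fg0).
rewrite -{2}[D]freeg_sumE [a *: D]/(fgscale a D) /fgscale !fgsum scaler_sumr.
by apply: eq_bigr => x _; rewrite !liftU scalerA.
Qed.

Definition flift : {linear {freeg X / k} -> W} := mklin fglift_is_linear.

Lemma flift_gen x : flift (fgen x) = g x.
Proof. by rewrite /= liftU scale1r. Qed.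

End FreeLift.

Lemma flift_ext (W : lmodType k) (f g : {linear {freeg X / k} -> W}) :
  (forall x, f (fgen x) = g (fgen x)) -> f =1 g.
Proof.
move=> fg D; rewrite -[D]freeg_sumE !linear_sum; apply: eq_bigr => x _.
have -> : << coeff x D *g x >> = coeff x D *: fgen x.
  by apply/eqP/freeg_eqP => y; rewrite coeffZ !coeffU mul1r.
by rewrite !linearZ fg.
Qed.

Variable S : {freeg X / k} -> Prop.

(* The vector space with generators X and relations D = 0 for D in S. *)
Definition pres : Type := vquot S.
HB.instance Definition _ := GRing.Lmodule.on pres.

Definition pgen (x : X) : pres := vpi S (fgen x).

Lemma pres_ext (W : lmodType k) (f g : {linear pres -> W}) :
  (forall x, f (pgen x) = g (pgen x)) -> f =1 g.
Proof.
move=> fg x; rewrite -[x]vreprK.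
pose vp : {linear {freeg X / k} -> pres} := vpi S.
exact: (@flift_ext _ (f \o vp) (g \o vp)).
Qed.

Lemma pres_rel D : S D -> vpi S D = 0.
Proof. by move=> SD; rewrite -(linear0 (vpi S)); apply/vpi_eq; rewrite subr0; exact: span_gen. Qed.

Section PresLift.
Variables (W : lmodType k) (g : X -> W).
Hypothesis gS : forall D, S D -> flift g D = 0.

Definition plift : {linear pres -> W} := vlift gS.

Lemma plift_gen x : plift (pgen x) = g x.
Proof. by rewrite [LHS]vliftE flift_gen. Qed.

End PresLift.
End Presentation.
Arguments fgen {k X} x.

Section Tensor.
Variables (k : fieldType) (V W : lmodType k).

(* Arbitrary (possibly infinite-dimensional) V and W: the free space on V * W
   modulo bilinearity. Universal property: [tensor_liftE] and [tensor_ext]. *)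
Inductive tensor_rel : {freeg (V * W)%type / k} -> Prop :=
| tensor_rel_l a v v' w :
    tensor_rel (fgen (a *: v + v', w) - (a *: fgen (v, w) + fgen (v', w)))
| tensor_rel_r a v w w' :
    tensor_rel (fgen (v, a *: w + w') - (a *: fgen (v, w) + fgen (v, w'))).

Definition tensor : Type := pres tensor_rel.
HB.instance Definition _ := GRing.Lmodule.on tensor.

Definition tens (v : V) (w : W) : tensor := pgen tensor_rel (v, w).

Lemma tens_linear_l w : linear (tens^~ w).
Proof.
move=> a v v'; apply/eqP; rewrite -subr_eq0; apply/eqP.
by have := pres_rel (tensor_rel_l a v v' w); rewrite linearB linearP.
Qed.

Lemma tens_linear_r v : linear (tens v).
Proof.
move=> a w w'; apply/eqP; rewrite -subr_eq0; apply/eqP.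
by have := pres_rel (tensor_rel_r a v w w'); rewrite linearB linearP.
Qed.

Lemma tensor_ext (T : lmodType k) (f g : {linear tensor -> T}) :
  (forall v w, f (tens v w) = g (tens v w)) -> f =1 g.
Proof. by move=> fg; apply: pres_ext => -[v w]; exact: fg. Qed.

Section Lift.
Variables (T : lmodType k) (b : V -> W -> T).
Hypothesis b_l : forall w, linear (b^~ w).
Hypothesis b_r : forall v, linear (b v).

Fact tensor_lift_rel D :
  tensor_rel D -> flift (fun vw : V * W => b vw.1 vw.2) D = 0.
Proof.
by case=> [a v v' w|a v w w']; rewrite linearB linearP !flift_gen /= ?b_l ?b_r
  subrr.
Qed.

Definition tensor_lift : {linear tensor -> T} := plift tensor_lift_rel.

Lemma tensor_liftE v w : tensor_lift (tens v w) = b v w.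
Proof. exact: plift_gen. Qed.

End Lift.
End Tensor.

Section TensorMap.
Variables (k : fieldType) (V V' W W' : lmodType k).
Variables (f : {linear V -> V'}) (g : {linear W -> W'}).

Fact tensor_map_l w : linear (fun v => tens (f v) (g w)).
Proof. by move=> a v v'; rewrite linearP tens_linear_l. Qed.

Fact tensor_map_r v : linear (fun w => tens (f v) (g w)).
Proof. by move=> a w w'; rewrite linearP tens_linear_r. Qed.

Definition tensor_map : {linear tensor V W -> tensor V' W'} :=
  tensor_lift tensor_map_l tensor_map_r.

Lemma tensor_mapE v w : tensor_map (tens v w) = tens (f v) (g w).
Proof. exact: tensor_liftE. Qed.

End TensorMap.

Definition mkomor d (P : porderType d) d' (Q : porderType d') (f : P -> Q)
    (f_homo : {homo f : p q / (p <= q)%O}) : {omorphism P -> Q} :=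
  HB.pack f (Order.isOrderMorphism.Build d P d' Q f f_homo).

Section Subposet.
Variables (d : Order.disp_t) (P : porderType d).

Definition subposet (A : pred P) : Type := {p : P | A p}.

Section Inst.
Variable A : pred P.
HB.instance Definition _ := [isSub of subposet A for @sval P A].
HB.instance Definition _ := [Choice of subposet A by <:].
HB.instance Definition _ := [SubChoice_isSubPOrder of subposet A by <: with d].

Fact incl_homo : {homo (val : subposet A -> P) : p q / (p <= q)%O}.
Proof. by move=> p q; rewrite Order.le_val. Qed.
Definition incl : {omorphism subposet A -> P} := mkomor incl_homo.
End Inst.

Definition subincl (A B : pred P) (sAB : forall p, A p -> B p) :
    subposet A -> subposet B :=
  fun p => exist _ (val p) (sAB _ (valP p)).

(* [subposet (upset p)] is the open set U_p. *)
Definition upset (p : P) : pred P := fun q => (p <= q)%O.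

Lemma upset_sub p p' (h : (p <= p')%O) q : upset p' q -> upset p q.
Proof. exact: le_trans. Qed.

End Subposet.

Section Projections.
Variables (d : Order.disp_t) (P : porderType d).

Fact pr1_homo : {homo (fun a : P *p P => a.1) : a b / (a <= b)%O}.
Proof. by move=> a b; rewrite leEprod => /andP[]. Qed.
Fact pr2_homo : {homo (fun a : P *p P => a.2) : a b / (a <= b)%O}.
Proof. by move=> a b; rewrite leEprod => /andP[]. Qed.

Definition pr1 : {omorphism P *p P -> P} := mkomor pr1_homo.
Definition pr2 : {omorphism P *p P -> P} := mkomor pr2_homo.

End Projections.

Section Persistence.
Variables (k : fieldType) (d : Order.disp_t) (P : porderType d).

(* Functors from the poset category P to k-vector spaces: since [p <= q] is a
   boolean, it has at most one proof, i.e. at most one morphism p -> q. *)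
Record pmod := PMod {
  pm_obj :> P -> lmodType k;
  pm_map : forall p q, (p <= q)%O -> {linear pm_obj p -> pm_obj q};
  pm_id : forall p (h : (p <= p)%O) x, pm_map h x = x;
  pm_comp : forall p q r (hpq : (p <= q)%O) (hqr : (q <= r)%O)
    (hpr : (p <= r)%O) x, pm_map hpr x = pm_map hqr (pm_map hpq x) }.

Record pm_hom (M N : pmod) := PMHom {
  hom_at :> forall p, {linear M p -> N p};
  hom_nat : forall p q (h : (p <= q)%O) x,
    hom_at q (pm_map M h x) = pm_map N h (hom_at p x) }.

Lemma pm_map_irr (M : pmod) p q (h h' : (p <= q)%O) x :
  pm_map M h x = pm_map M h' x.
Proof. by rewrite (bool_irrelevance h h'). Qed.

Lemma hom_ext (M N : pmod) (f g : pm_hom M N) : (forall p, f p =1 g p) -> f = g.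
Proof.
case: f g => [f fn] [g gn] /= fg.
have e : f = g by apply: functional_extensionality_dep => p; exact/linear_ext/fg.
by subst g; rewrite (Prop_irrelevance fn gn).
Qed.

Definition hom_id (M : pmod) : pm_hom M M :=
  PMHom (hom_at := fun p => (idfun : {linear M p -> M p})) (fun _ _ _ _ => erefl).

Fact hom_comp_nat (M N L : pmod) (g : pm_hom N L) (f : pm_hom M N)
  p q (h : (p <= q)%O) x :
  (g q \o f q) (pm_map M h x) = pm_map L h ((g p \o f p) x).
Proof. by rewrite /= !hom_nat. Qed.

Definition hom_comp (M N L : pmod) (g : pm_hom N L) (f : pm_hom M N) :
  pm_hom M L := PMHom (hom_comp_nat g f).

Section HomSpace.
Variables M N : pmod.
Implicit Types f g : pm_hom M N.

HB.instance Definition _ := gen_eqMixin (pm_hom M N).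
HB.instance Definition _ := gen_choiceMixin (pm_hom M N).

Fact hom_zero_nat p q (h : (p <= q)%O) x :
  (\0 : M q -> N q) (pm_map M h x) = pm_map N h ((\0 : M p -> N p) x).
Proof. by rewrite linear0. Qed.
Fact hom_opp_nat f p q (h : (p <= q)%O) x :
  (\- f q) (pm_map M h x) = pm_map N h ((\- f p) x).
Proof. by rewrite /= hom_nat linearN. Qed.
Fact hom_add_nat f g p q (h : (p <= q)%O) x :
  (f q \+ g q) (pm_map M h x) = pm_map N h ((f p \+ g p) x).
Proof. by rewrite /= !hom_nat linearD. Qed.
Fact hom_scale_nat a f p q (h : (p <= q)%O) x :
  (a \*: f q) (pm_map M h x) = pm_map N h ((a \*: f p) x).
Proof. by rewrite /= !hom_nat linearZ. Qed.

Definition hom_zero : pm_hom M N := PMHom hom_zero_nat.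
Definition hom_opp f : pm_hom M N := PMHom (hom_opp_nat f).
Definition hom_add f g : pm_hom M N := PMHom (hom_add_nat f g).
Definition hom_scale a f : pm_hom M N := PMHom (hom_scale_nat a f).

Fact hom_addA : associative hom_add.
Proof. by move=> f g h; apply: hom_ext => p x /=; rewrite addrA. Qed.
Fact hom_addC : commutative hom_add.
Proof. by move=> f g; apply: hom_ext => p x /=; rewrite addrC. Qed.
Fact hom_add0 : left_id hom_zero hom_add.
Proof. by move=> f; apply: hom_ext => p x /=; rewrite add0r. Qed.
Fact hom_addN : left_inverse hom_zero hom_opp hom_add.
Proof. by move=> f; apply: hom_ext => p x /=; rewrite addNr. Qed.

HB.instance Definition _ := GRing.isZmodule.Build (pm_hom M N)
  hom_addA hom_addC hom_add0 hom_addN.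

Fact hom_scaleA a b f : hom_scale a (hom_scale b f) = hom_scale (a * b) f.
Proof. by apply: hom_ext => p x /=; rewrite scalerA. Qed.
Fact hom_scale1 : left_id 1 hom_scale.
Proof. by move=> f; apply: hom_ext => p x /=; rewrite scale1r. Qed.
Fact hom_scaleDr : right_distributive hom_scale +%R.
Proof. by move=> a f g; apply: hom_ext => p x /=; rewrite scalerDr. Qed.
Fact hom_scaleDl f : {morph hom_scale^~ f : a b / a + b}.
Proof. by move=> a b; apply: hom_ext => p x /=; rewrite scalerDl. Qed.

HB.instance Definition _ := GRing.Zmodule_isLmodule.Build k (pm_hom M N)
  hom_scaleA hom_scale1 hom_scaleDr hom_scaleDl.

Lemma hom_linearE a f g p x : (a *: f + g) p x = a *: f p x + g p x.
Proof. by []. Qed.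

End HomSpace.
End Persistence.

Section Functors.
Variable k : fieldType.

Record pm_functor d (P : porderType d) d' (Q : porderType d') := PMFunctor {
  fobj :> pmod k P -> pmod k Q;
  fmap : forall M N, pm_hom M N -> pm_hom (fobj M) (fobj N);
  fmap_id : forall M, fmap (hom_id M) = hom_id (fobj M);
  fmap_comp : forall M N L (g : pm_hom N L) (f : pm_hom M N),
    fmap (hom_comp g f) = hom_comp (fmap g) (fmap f) }.

Section Comp.
Variables (d : Order.disp_t) (P : porderType d).
Variables (d' : Order.disp_t) (Q : porderType d').
Variables (d'' : Order.disp_t) (R : porderType d'').
Variables (G : pm_functor Q R) (F : pm_functor P Q).

Fact functor_comp_id M : fmap G (fmap F (hom_id M)) = hom_id (G (F M)).
Proof. by rewrite !fmap_id. Qed.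
Fact functor_comp_comp M N L (g : pm_hom N L) (f : pm_hom M N) :
  fmap G (fmap F (hom_comp g f)) =
  hom_comp (fmap G (fmap F g)) (fmap G (fmap F f)).
Proof. by rewrite !fmap_comp. Qed.

Definition functor_comp : pm_functor P R := PMFunctor
  (fobj := fun M => G (F M)) (fmap := fun M N f => fmap G (fmap F f))
  functor_comp_id functor_comp_comp.
End Comp.

(* Hom-set adjunction: bijections Hom(F N, L) -> Hom(N, G L) natural in N and L. *)
Definition left_adjoint d (P : porderType d) d' (Q : porderType d')
    (F : pm_functor P Q) (G : pm_functor Q P) : Prop :=
  exists Phi : forall N L, pm_hom (F N) L -> pm_hom N (G L),
    (forall N L, bijective (Phi N L)) /\
    (forall N N' L L' (f : pm_hom N' N) (g : pm_hom L L') (h : pm_hom (F N) L),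
       Phi N' L' (hom_comp g (hom_comp h (fmap F f))) =
       hom_comp (fmap G g) (hom_comp (Phi N L h) f)).

End Functors.

Section Pullback.
Variables (k : fieldType) (d : Order.disp_t) (P : porderType d).
Variables (d' : Order.disp_t) (Q : porderType d') (f : {omorphism P -> Q}).

Section Obj.
Variable G : pmod k Q.
Fact pullback_id p (h : (p <= p)%O) x : pm_map G (omorph_le f h) x = x.
Proof. exact: pm_id. Qed.
Fact pullback_comp p q r (hpq : (p <= q)%O) (hqr : (q <= r)%O)
    (hpr : (p <= r)%O) x :
  pm_map G (omorph_le f hpr) x =
  pm_map G (omorph_le f hqr) (pm_map G (omorph_le f hpq) x).
Proof. exact: pm_comp. Qed.

Definition pullback : pmod k P := PMod (pm_obj := fun p => G (f p))
  (pm_map := fun p q h => pm_map G (omorph_le f h)) pullback_id pullback_comp.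
End Obj.

Definition pullback_hom G H (u : pm_hom G H) :
    pm_hom (pullback G) (pullback H) :=
  @PMHom k d P (pullback G) (pullback H) (fun p => u (f p))
    (fun p q h x => hom_nat u (omorph_le f h) x).

Definition pullback_functor : pm_functor k Q P.
Proof.
by exists pullback pullback_hom => *; apply: hom_ext.
Defined.

End Pullback.

Section Limit.
Variables (k : fieldType) (d : Order.disp_t) (P : porderType d) (M : pmod k P).

(* The limit of M : P -> Vect, as the space of compatible families. *)
Record limit := Limit {
  lim_at :> forall p, M p;
  lim_compat : forall p q (h : (p <= q)%O), pm_map M h (lim_at p) = lim_at q }.
Implicit Types x y z : limit.

Lemma limit_ext x y : (forall p, x p = y p) -> x = y.
Proof.
case: x y => [x xc] [y yc] /= xy.
have e : x = y by exact: functional_extensionality_dep.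
by subst y; rewrite (Prop_irrelevance xc yc).
Qed.

HB.instance Definition _ := gen_eqMixin limit.
HB.instance Definition _ := gen_choiceMixin limit.

Fact lim_zero_compat p q (h : (p <= q)%O) : pm_map M h 0 = 0.
Proof. exact: linear0. Qed.
Fact lim_opp_compat x p q (h : (p <= q)%O) : pm_map M h (- x p) = - x q.
Proof. by rewrite linearN lim_compat. Qed.
Fact lim_add_compat x y p q (h : (p <= q)%O) :
  pm_map M h (x p + y p) = x q + y q.
Proof. by rewrite linearD !lim_compat. Qed.
Fact lim_scale_compat a x p q (h : (p <= q)%O) :
  pm_map M h (a *: x p) = a *: x q.
Proof. by rewrite linearZ lim_compat. Qed.

Definition lim_zero : limit := Limit lim_zero_compat.
Definition lim_opp x : limit := Limit (lim_opp_compat x).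
Definition lim_add x y : limit := Limit (lim_add_compat x y).
Definition lim_scale a x : limit := Limit (lim_scale_compat a x).

Fact lim_addA : associative lim_add.
Proof. by move=> x y z; apply: limit_ext => p /=; rewrite addrA. Qed.
Fact lim_addC : commutative lim_add.
Proof. by move=> x y; apply: limit_ext => p /=; rewrite addrC. Qed.
Fact lim_add0 : left_id lim_zero lim_add.
Proof. by move=> x; apply: limit_ext => p /=; rewrite add0r. Qed.
Fact lim_addN : left_inverse lim_zero lim_opp lim_add.
Proof. by move=> x; apply: limit_ext => p /=; rewrite addNr. Qed.

HB.instance Definition _ := GRing.isZmodule.Build limit
  lim_addA lim_addC lim_add0 lim_addN.

Fact lim_scaleA a b x : lim_scale a (lim_scale b x) = lim_scale (a * b) x.
Proof. by apply: limit_ext => p /=; rewrite scalerA. Qed.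
Fact lim_scale1 : left_id 1 lim_scale.
Proof. by move=> x; apply: limit_ext => p /=; rewrite scale1r. Qed.
Fact lim_scaleDr : right_distributive lim_scale +%R.
Proof. by move=> a x y; apply: limit_ext => p /=; rewrite scalerDr. Qed.
Fact lim_scaleDl x : {morph lim_scale^~ x : a b / a + b}.
Proof. by move=> a b; apply: limit_ext => p /=; rewrite scalerDl. Qed.

HB.instance Definition _ := GRing.Zmodule_isLmodule.Build k limit
  lim_scaleA lim_scale1 lim_scaleDr lim_scaleDl.

Lemma lim_at_is_linear p : linear (fun x => x p).
Proof. by []. Qed.

Section Lift.
Variables (W : lmodType k) (g : forall p, {linear W -> M p}).
Hypothesis g_compat : forall p q (h : (p <= q)%O) w, pm_map M h (g p w) = g q w.

Definition lim_lift_fun (w : W) : limit := Limit (fun p q h => g_compat h w).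

Fact lim_lift_is_linear : linear lim_lift_fun.
Proof. by move=> a v w; apply: limit_ext => p /=; rewrite linearP. Qed.

Definition lim_lift : {linear W -> limit} := mklin lim_lift_is_linear.

End Lift.
End Limit.

Section Pushforward.
Variables (k : fieldType) (d : Order.disp_t) (P : porderType d).
Variables (d' : Order.disp_t) (Q : porderType d') (f : {omorphism P -> Q}).

Definition above (q : Q) : pred P := fun p => (q <= f p)%O.

Lemma above_sub q q' (h : (q <= q')%O) p : above q' p -> above q p.
Proof. exact: le_trans. Qed.

(* (f_* F)_q: the limit of F over the subposet of the p with q <= f p. *)
Definition lim_above (F : pmod k P) (q : Q) : lmodType k :=
  limit (pullback (incl (above q)) F).

Section Obj.
Variable F : pmod k P.

Section Map.
Variables (q q' : Q) (h : (q <= q')%O).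

Fact pushforward_map_compat (x : lim_above F q)
    (p p' : subposet (above q')) (hp : (p <= p')%O) :
  pm_map (pullback (incl (above q')) F) hp (x (subincl (above_sub h) p)) =
  x (subincl (above_sub h) p').
Proof.
rewrite -(lim_compat x (p := subincl (above_sub h) p)
  (q := subincl (above_sub h) p') hp); exact: (pm_map_irr (M := F)).
Qed.

Definition pushforward_map_fun (x : lim_above F q) : lim_above F q' :=
  Limit (pushforward_map_compat x).

Fact pushforward_map_is_linear : linear pushforward_map_fun.
Proof. by move=> a x y; apply: limit_ext. Qed.

Definition pushforward_map : {linear lim_above F q -> lim_above F q'} :=
  mklin pushforward_map_is_linear.
End Map.

Lemma lim_above_irr q (x : lim_above F q) p (h h' : above q p) :
  x (exist _ p h) = x (exist _ p h') :> F p.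
Proof. by rewrite (bool_irrelevance h h'). Qed.

Fact pushforward_id q (h : (q <= q)%O) x : pushforward_map h x = x.
Proof. by apply: limit_ext => -[p hp]; exact: (@lim_above_irr _ x p _ hp). Qed.

Fact pushforward_comp p q r (hpq : (p <= q)%O) (hqr : (q <= r)%O)
    (hpr : (p <= r)%O) x :
  pushforward_map hpr x = pushforward_map hqr (pushforward_map hpq x).
Proof. by apply: limit_ext => -[a ha]; exact: (@lim_above_irr _ x a). Qed.

Definition pushforward : pmod k Q :=
  PMod (pm_map := fun p q h => pushforward_map h)
    pushforward_id pushforward_comp.
End Obj.

Section Hom.
Variables (F G : pmod k P) (u : pm_hom F G).

Fact lim_above_hom_compat q (x : lim_above F q) (p p' : subposet (above q))
    (h : (p <= p')%O) :
  pm_map (pullback (incl (above q)) G) h (u (val p) (x p)) = u (val p') (x p').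
Proof. by rewrite /= -hom_nat -(lim_compat x h). Qed.

Definition lim_above_hom_fun q (x : lim_above F q) : lim_above G q :=
  Limit (lim_above_hom_compat x).

Fact lim_above_hom_is_linear q : linear (@lim_above_hom_fun q).
Proof. by move=> a x y; apply: limit_ext => p /=; rewrite linearP. Qed.

Definition lim_above_hom q : {linear pushforward F q -> pushforward G q} :=
  mklin (@lim_above_hom_is_linear q).

Fact pushforward_hom_nat q q' (h : (q <= q')%O) (x : pushforward F q) :
  lim_above_hom q' (pm_map (pushforward F) h x) =
  pm_map (pushforward G) h (lim_above_hom q x).
Proof. exact: limit_ext. Qed.

Definition pushforward_hom : pm_hom (pushforward F) (pushforward G) :=
  PMHom (hom_at := lim_above_hom) pushforward_hom_nat.
End Hom.

Definition pushforward_functor : pm_functor k P Q.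
Proof.
by exists pushforward pushforward_hom => *; apply: hom_ext => q x;
  apply: limit_ext.
Defined.

End Pushforward.

Section Colimit.
Variables (k : fieldType) (d : Order.disp_t) (P : porderType d) (M : pmod k P).

Definition elt : choiceType := {p : P & M p}.
Definition mkelt p (x : M p) : elt := Tagged (fun p => M p : choiceType) x.

(* The colimit of M : P -> Vect is generated by the pairs (p, x) with x in M p.
   Universal property: [colim_liftE] and [colim_ext]. *)
Inductive colim_rel : {freeg elt / k} -> Prop :=
| colim_rel_lin p a (x y : M p) :
    colim_rel (fgen (mkelt (a *: x + y)) -
               (a *: fgen (mkelt x) + fgen (mkelt y)))
| colim_rel_map p q (h : (p <= q)%O) (x : M p) :
    colim_rel (fgen (mkelt (pm_map M h x)) - fgen (mkelt x)).

Definition colimit : Type := pres colim_rel.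
HB.instance Definition _ := GRing.Lmodule.on colimit.

Definition colim_in p (x : M p) : colimit := pgen colim_rel (mkelt x).

Lemma colim_in_linear p : linear (@colim_in p).
Proof.
move=> a x y; apply/eqP; rewrite -subr_eq0; apply/eqP.
by have := pres_rel (colim_rel_lin a x y); rewrite linearB linearP.
Qed.

Lemma colim_in_compat p q (h : (p <= q)%O) (x : M p) :
  colim_in (pm_map M h x) = colim_in x.
Proof.
apply/eqP; rewrite -subr_eq0; apply/eqP.
by have := pres_rel (colim_rel_map h x); rewrite linearB.
Qed.

Lemma colim_ext (W : lmodType k) (f g : {linear colimit -> W}) :
  (forall p (x : M p), f (colim_in x) = g (colim_in x)) -> f =1 g.
Proof. by move=> fg; apply: pres_ext => -[p x]; exact: fg. Qed.

Section Lift.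
Variables (W : lmodType k) (g : forall p, M p -> W).
Hypothesis g_lin : forall p, linear (@g p).
Hypothesis g_compat : forall p q (h : (p <= q)%O) (x : M p),
  g (pm_map M h x) = g x.

Fact colim_lift_rel D :
  colim_rel D -> flift (fun e : elt => g (tagged e)) D = 0.
Proof.
case=> [p a x y|p q h x].
  by rewrite linearB linearP !flift_gen; apply/eqP; rewrite subr_eq0 g_lin.
by rewrite linearB !flift_gen; apply/eqP; rewrite subr_eq0 g_compat.
Qed.

Definition colim_lift : {linear colimit -> W} := plift colim_lift_rel.

Lemma colim_liftE p (x : M p) : colim_lift (colim_in x) = g x.
Proof. exact: plift_gen. Qed.

End Lift.
End Colimit.

Section CoPushforward.
Variables (k : fieldType) (d : Order.disp_t) (P : porderType d).
Variables (d' : Order.disp_t) (Q : porderType d') (f : {omorphism P -> Q}).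

Definition below (q : Q) : pred P := fun p => (f p <= q)%O.

Lemma below_sub q q' (h : (q <= q')%O) p : below q p -> below q' p.
Proof. by move=> hp; exact: le_trans h. Qed.

(* (f_dagger F)_q: the colimit of F over the subposet of the p with f p <= q. *)
Definition colim_below (F : pmod k P) (q : Q) : lmodType k :=
  colimit (pullback (incl (below q)) F).

Section Obj.
Variable F : pmod k P.

Definition colim_below_in q p (h : below q p) (x : F p) : colim_below F q :=
  colim_in (M := pullback (incl (below q)) F) (p := exist _ p h) x.

Lemma colim_below_in_linear q p (h : below q p) : linear (colim_below_in h).
Proof. exact (@colim_in_linear k _ _ (pullback (incl (below q)) F) (exist _ p h)). Qed.

Lemma colim_below_in_compat q p p' (h : below q p) (h' : below q p')
    (hp : (p <= p')%O) (x : F p) :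
  colim_below_in h' (pm_map F hp x) = colim_below_in h x.
Proof.
refine (etrans _ (@colim_in_compat k _ _ (pullback (incl (below q)) F)
  (exist _ p h) (exist _ p' h') hp x)).
by rewrite /colim_below_in /= (pm_map_irr _ hp).
Qed.

Lemma colim_below_ext q (W : lmodType k) (g g' : {linear colim_below F q -> W}) :
  (forall p (h : below q p) (x : F p),
     g (colim_below_in h x) = g' (colim_below_in h x)) -> g =1 g'.
Proof. by move=> gg'; apply: colim_ext => -[p h] x; exact: gg'. Qed.

Section Map.
Variables (q q' : Q) (h : (q <= q')%O).

Definition copushforward_map_gen (p : subposet (below q)) (x : F (val p)) :
  colim_below F q' := colim_below_in (below_sub h (valP p)) x.

Fact copushforward_map_linear p : linear (@copushforward_map_gen p).
Proof. exact: colim_below_in_linear. Qed.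

Fact copushforward_map_compat (p p' : subposet (below q)) (hp : (p <= p')%O)
    (x : pullback (incl (below q)) F p) :
  copushforward_map_gen (pm_map (pullback (incl (below q)) F) hp x) =
  copushforward_map_gen x.
Proof. exact: colim_below_in_compat. Qed.

Definition copushforward_map : {linear colim_below F q -> colim_below F q'} :=
  colim_lift (M := pullback (incl (below q)) F) (g := copushforward_map_gen)
    copushforward_map_linear copushforward_map_compat.

Lemma copushforward_mapE p (hp : below q p) (hp' : below q' p) (x : F p) :
  copushforward_map (colim_below_in hp x) = colim_below_in hp' x.
Proof.
rewrite [LHS]colim_liftE /copushforward_map_gen.
by rewrite (bool_irrelevance hp' (below_sub h (valP (exist _ p hp)))).
Qed.
End Map.

Fact copushforward_id q (h : (q <= q)%O) x : copushforward_map h x = x.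
Proof.
apply: (@colim_below_ext q _ (copushforward_map h) idfun) => p hp y.
exact: copushforward_mapE.
Qed.

Fact copushforward_comp p q r (hpq : (p <= q)%O) (hqr : (q <= r)%O)
    (hpr : (p <= r)%O) x :
  copushforward_map hpr x = copushforward_map hqr (copushforward_map hpq x).
Proof.
apply: (@colim_below_ext p _ (copushforward_map hpr)
  (copushforward_map hqr \o copushforward_map hpq)) => a ha y.
have ha' := below_sub hpq ha; have ha'' := below_sub hqr ha'.
rewrite (copushforward_mapE hpr ha ha'') -(copushforward_mapE hqr ha' ha'').
by rewrite -(copushforward_mapE hpq ha ha').
Qed.

Definition copushforward : pmod k Q :=
  PMod (pm_map := fun p q h => copushforward_map h)
    copushforward_id copushforward_comp.
End Obj.

Section Hom.
Variables (F G : pmod k P) (u : pm_hom F G).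

Section At.
Variable q : Q.

Definition copushforward_hom_gen (p : subposet (below q)) (x : F (val p)) :
  colim_below G q := colim_below_in (valP p) (u (val p) x).

Fact copushforward_hom_linear p : linear (@copushforward_hom_gen p).
Proof.
move=> a x y; rewrite /copushforward_hom_gen linearP.
exact: colim_below_in_linear.
Qed.

Fact copushforward_hom_compat (p p' : subposet (below q)) (hp : (p <= p')%O)
    (x : pullback (incl (below q)) F p) :
  copushforward_hom_gen (pm_map (pullback (incl (below q)) F) hp x) =
  copushforward_hom_gen x.
Proof. by rewrite /copushforward_hom_gen hom_nat; exact: colim_below_in_compat. Qed.

Definition copushforward_hom_at : {linear copushforward F q -> copushforward G q} :=
  colim_lift (M := pullback (incl (below q)) F) (g := copushforward_hom_gen)
    copushforward_hom_linear copushforward_hom_compat.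

Lemma copushforward_homE p (hp : below q p) (x : F p) :
  copushforward_hom_at (colim_below_in hp x) = colim_below_in hp (u p x).
Proof.
rewrite [LHS]colim_liftE /copushforward_hom_gen.
by rewrite (bool_irrelevance (valP (exist _ p hp)) hp).
Qed.
End At.

Fact copushforward_hom_nat q q' (h : (q <= q')%O) (x : copushforward F q) :
  copushforward_hom_at q' (pm_map (copushforward F) h x) =
  pm_map (copushforward G) h (copushforward_hom_at q x).
Proof.
apply: (@colim_below_ext F q _ (copushforward_hom_at q' \o copushforward_map F h)
  (copushforward_map G h \o copushforward_hom_at q)) => p hp y.
have hp' := below_sub h hp; transitivity (colim_below_in hp' (u p y)).
  rewrite -copushforward_homE -(copushforward_mapE h hp hp'); exact: erefl.
rewrite -(copushforward_mapE h hp hp') -copushforward_homE; exact: erefl.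
Qed.

Definition copushforward_hom : pm_hom (copushforward F) (copushforward G) :=
  PMHom (hom_at := copushforward_hom_at) copushforward_hom_nat.
End Hom.

Fact copushforward_hom_id F :
  copushforward_hom (hom_id F) = hom_id (copushforward F).
Proof.
apply: hom_ext => q; apply: colim_below_ext => p hp x.
exact: copushforward_homE.
Qed.

Fact copushforward_hom_comp F G H (v : pm_hom G H) (u : pm_hom F G) :
  copushforward_hom (hom_comp v u) =
  hom_comp (copushforward_hom v) (copushforward_hom u).
Proof.
apply: hom_ext => q; apply: colim_below_ext => p hp x.
rewrite [LHS]copushforward_homE; apply: esym.
apply: (etrans (congr1 (copushforward_hom_at v q) (copushforward_homE u hp x))).
exact: copushforward_homE.
Qed.

Definition copushforward_functor : pm_functor k P Q :=
  PMFunctor copushforward_hom_id copushforward_hom_comp.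

End CoPushforward.

Section PointwiseTensor.
Variables (k : fieldType) (d : Order.disp_t) (P : porderType d).

Section Obj.
Variables M N : pmod k P.

Fact ptensor_id p (h : (p <= p)%O) x :
  tensor_map (pm_map M h) (pm_map N h) x = x.
Proof.
apply: (@tensor_ext _ _ _ _ (tensor_map (pm_map M h) (pm_map N h)) idfun).
by move=> v w; rewrite tensor_mapE !pm_id.
Qed.

Fact ptensor_comp p q r (hpq : (p <= q)%O) (hqr : (q <= r)%O)
    (hpr : (p <= r)%O) x :
  tensor_map (pm_map M hpr) (pm_map N hpr) x =
  tensor_map (pm_map M hqr) (pm_map N hqr)
    (tensor_map (pm_map M hpq) (pm_map N hpq) x).
Proof.
pose t a b (h : (a <= b)%O) := tensor_map (pm_map M h) (pm_map N h).
apply: (@tensor_ext _ _ _ _ (t _ _ hpr) (t _ _ hqr \o t _ _ hpq)) => v w.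
rewrite tensor_mapE (pm_comp hpq hqr) (pm_comp hpq hqr) -!tensor_mapE.
exact: erefl.
Qed.

Definition ptensor : pmod k P := PMod
  (pm_obj := fun p => tensor (M p) (N p) : lmodType k)
  (pm_map := fun p q h => tensor_map (pm_map M h) (pm_map N h))
  ptensor_id ptensor_comp.
End Obj.

Section Hom.
Variables (M M' N N' : pmod k P) (u : pm_hom M M') (v : pm_hom N N').

Definition ptensor_hom_at p : {linear ptensor M N p -> ptensor M' N' p} :=
  tensor_map (u p) (v p).

Fact ptensor_hom_nat p q (h : (p <= q)%O) x :
  ptensor_hom_at q (pm_map (ptensor M N) h x) =
  pm_map (ptensor M' N') h (ptensor_hom_at p x).
Proof.
apply: (@tensor_ext _ _ _ _ (ptensor_hom_at q \o pm_map (ptensor M N) h)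
  (pm_map (ptensor M' N') h \o ptensor_hom_at p)) => m n.
change (tensor_map (u q) (v q) (tensor_map (pm_map M h) (pm_map N h) (tens m n)) =
  tensor_map (pm_map M' h) (pm_map N' h) (tensor_map (u p) (v p) (tens m n))).
by rewrite !tensor_mapE !hom_nat.
Qed.

Definition ptensor_hom : pm_hom (ptensor M N) (ptensor M' N') :=
  PMHom (hom_at := ptensor_hom_at) ptensor_hom_nat.
End Hom.

Fact ptensor_hom_id (M N : pmod k P) :
  ptensor_hom (hom_id M) (hom_id N) = hom_id (ptensor M N).
Proof.
by apply: hom_ext => p; apply: tensor_ext => m n; rewrite [LHS]tensor_mapE.
Qed.

Fact ptensor_hom_comp (M M' M'' N N' N'' : pmod k P)
    (u' : pm_hom M' M'') (u : pm_hom M M')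
    (v' : pm_hom N' N'') (v : pm_hom N N') :
  ptensor_hom (hom_comp u' u) (hom_comp v' v) =
  hom_comp (ptensor_hom u' v') (ptensor_hom u v).
Proof.
apply: hom_ext => p; apply: tensor_ext => m n.
change (tensor_map (hom_comp u' u p) (hom_comp v' v p) (tens m n) =
  tensor_map (u' p) (v' p) (tensor_map (u p) (v p) (tens m n))).
by rewrite !tensor_mapE.
Qed.

Lemma hom_comp_id (M : pmod k P) : hom_comp (hom_id M) (hom_id M) = hom_id M.
Proof. exact: hom_ext. Qed.

Definition ptensor_functor_r (M : pmod k P) : pm_functor k P P.
Proof.
exists (fun N => ptensor M N) (fun N N' v => ptensor_hom (hom_id M) v).
- by move=> N; exact: ptensor_hom_id.
- by move=> N N' N'' v' v; rewrite -{1}(hom_comp_id M) ptensor_hom_comp.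
Defined.

Definition ptensor_functor_l (N : pmod k P) : pm_functor k P P.
Proof.
exists (fun M => ptensor M N) (fun M M' u => ptensor_hom u (hom_id N)).
- by move=> M; exact: ptensor_hom_id.
- by move=> M M' M'' u' u; rewrite -{1}(hom_comp_id N) ptensor_hom_comp.
Defined.

End PointwiseTensor.

Section SheafHom.
Variables (k : fieldType) (d : Order.disp_t) (P : porderType d).

Definition restr (M : pmod k P) (p : P) : pmod k (subposet (upset p)) :=
  pullback (incl (upset p)) M.

Definition local_hom (M N : pmod k P) (p : P) : lmodType k :=
  pm_hom (restr M p) (restr N p).

Section Obj.
Variables M N : pmod k P.

Section Map.
Variables (p p' : P) (h : (p <= p')%O).

Fact hom_restr_nat (u : local_hom M N p) (q q' : subposet (upset p'))
    (hq : (q <= q')%O) (x : restr M p' q) :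
  u (subincl (upset_sub h) q') (pm_map (restr M p') hq x) =
  pm_map (restr N p') hq (u (subincl (upset_sub h) q) x).
Proof.
have hq' : (subincl (upset_sub h) q <= subincl (upset_sub h) q')%O := hq.
have /= e := hom_nat u hq' x.
by rewrite /= (bool_irrelevance (omorph_le (incl (upset p')) hq)
  (omorph_le (incl (upset p)) hq')).
Qed.

Definition hom_restr_fun (u : local_hom M N p) : local_hom M N p' :=
  @PMHom k _ _ (restr M p') (restr N p')
    (fun q => u (subincl (upset_sub h) q)) (hom_restr_nat u).

Fact hom_restr_is_linear : linear hom_restr_fun.
Proof. by move=> a u v; apply: hom_ext. Qed.

Definition hom_restr : {linear local_hom M N p -> local_hom M N p'} :=
  mklin hom_restr_is_linear.
End Map.

Lemma local_hom_irr p (u : local_hom M N p) q (h h' : upset p q) (x : M q) :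
  u (exist _ q h) x = u (exist _ q h') x :> N q.
Proof. by rewrite (bool_irrelevance h h'). Qed.

Fact sheaf_hom_id p (h : (p <= p)%O) u : hom_restr h u = u.
Proof. by apply: hom_ext => -[q hq] x; exact: (@local_hom_irr _ u q _ _ x). Qed.

Fact sheaf_hom_comp p q r (hpq : (p <= q)%O) (hqr : (q <= r)%O)
    (hpr : (p <= r)%O) u :
  hom_restr hpr u = hom_restr hqr (hom_restr hpq u).
Proof. by apply: hom_ext => -[a ha] x; exact: (@local_hom_irr _ u a _ _ x). Qed.

Definition sheaf_hom : pmod k P :=
  PMod (pm_map := fun p q h => hom_restr h) sheaf_hom_id sheaf_hom_comp.
End Obj.

Section Hom.
Variables (M N N' : pmod k P) (v : pm_hom N N').

Definition sheaf_hom_post_fun p (u : local_hom M N p) : local_hom M N' p :=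
  hom_comp (pullback_hom (incl (upset p)) v) u.

Fact sheaf_hom_post_is_linear p : linear (@sheaf_hom_post_fun p).
Proof. by move=> a u w; apply: hom_ext => q x /=; rewrite linearP. Qed.

Definition sheaf_hom_post_at p : {linear sheaf_hom M N p -> sheaf_hom M N' p} :=
  mklin (@sheaf_hom_post_is_linear p).

Fact sheaf_hom_post_nat p q (h : (p <= q)%O) u :
  sheaf_hom_post_at q (pm_map (sheaf_hom M N) h u) =
  pm_map (sheaf_hom M N') h (sheaf_hom_post_at p u).
Proof. exact: hom_ext. Qed.

Definition sheaf_hom_post : pm_hom (sheaf_hom M N) (sheaf_hom M N') :=
  PMHom (hom_at := sheaf_hom_post_at) sheaf_hom_post_nat.
End Hom.

Definition sheaf_hom_functor (M : pmod k P) : pm_functor k P P.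
Proof.
by exists (sheaf_hom M) (@sheaf_hom_post M) => *; apply: hom_ext => p u;
  apply: hom_ext.
Defined.

End SheafHom.

Section Phi.
Variables (k : fieldType) (d : Order.disp_t) (P : porderType d).
Variable phi : {omorphism P *p P -> P}.
Local Notation pi1 := (pr1 P).
Local Notation pi2 := (pr2 P).

(* [phi_homr] is Hom^phi (direct image along the second projection), [phi_homl]
   is ^phi Hom (along the first). *)
Definition phi_tensor (M N : pmod k P) : pmod k P :=
  copushforward phi (ptensor (pullback pi1 M) (pullback pi2 N)).

Definition phi_homr (M L : pmod k P) : pmod k P :=
  pushforward pi2 (sheaf_hom (pullback pi1 M) (pullback phi L)).

Definition phi_homl (M L : pmod k P) : pmod k P :=
  pushforward pi1 (sheaf_hom (pullback pi2 M) (pullback phi L)).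

Definition phi_tensor_functor_r (M : pmod k P) : pm_functor k P P :=
  functor_comp (copushforward_functor k phi)
    (functor_comp (ptensor_functor_r (pullback pi1 M)) (pullback_functor k pi2)).

Definition phi_tensor_functor_l (M : pmod k P) : pm_functor k P P :=
  functor_comp (copushforward_functor k phi)
    (functor_comp (ptensor_functor_l (pullback pi2 M)) (pullback_functor k pi1)).

Definition phi_homr_functor (M : pmod k P) : pm_functor k P P :=
  functor_comp (pushforward_functor k pi2)
    (functor_comp (sheaf_hom_functor (pullback pi1 M)) (pullback_functor k phi)).

Definition phi_homl_functor (M : pmod k P) : pm_functor k P P :=
  functor_comp (pushforward_functor k pi1)
    (functor_comp (sheaf_hom_functor (pullback pi2 M)) (pullback_functor k phi)).

(* M (x)_phi -, - (x)_phi M, Hom^phi(M, -) and ^phi Hom(M, -) on objects. *)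
Lemma phi_tensor_functor_rE M N : phi_tensor_functor_r M N = phi_tensor M N.
Proof. by []. Qed.
Lemma phi_tensor_functor_lE M N : phi_tensor_functor_l M N = phi_tensor N M.
Proof. by []. Qed.
Lemma phi_homr_functorE M L : phi_homr_functor M L = phi_homr M L.
Proof. by []. Qed.
Lemma phi_homl_functorE M L : phi_homl_functor M L = phi_homl M L.
Proof. by []. Qed.

End Phi.

(* Main.v *)
Require Import Defs.
From mathcomp Require Import all_boot all_order all_algebra.

Set Implicit Arguments.
Unset Strict Implicit.
Unset Printing Implicit Defensive.

Import Order.TTheory GRing.Theory.
Local Open Scope ring_scope.

(** Both functors are built from three elementary operations, each of which
    belongs to an adjoint pair:
      - inverse image is left adjoint to direct image,
        f^-1 -| f_* ([pullback_pushforward_adj]);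
      - pointwise tensor product with M is left adjoint to the sheaf internal
        hom out of M ([ptensor_sheaf_hom_adj]);
      - f_dagger is left adjoint to inverse image,
        f_dagger -| f^-1 ([copushforward_pullback_adj]).
    The functor sending N to phi_dagger (pi_1^-1 M (x) pi_2^-1 N) is the
    composite of pi_2^-1, of tensoring with pi_1^-1 M, and of phi_dagger; its
    right adjoint is the composite of the three right adjoints in the opposite
    order, L |-> pi_2* Hom (pi_1^-1 M, phi^-1 L), which is Hom^phi (M, L).
    Exchanging the two projections gives the second adjunction, except that the
    fixed module now stands on the right of the tensor product; since the
    pointwise tensor product is symmetric, the adjunction with the internal
    hom can be transported along the swap ([ptensor_sheaf_hom_adj_l]).

    Each elementary bijection comes from a universal property. A map out of the
    colimit (f_dagger F)_q is a compatible family of maps out of the F_p with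
    f p <= q, and naturality in q makes this family determined by its members
    at q = f p. Dually, a map into the limit (f_* F)_q is determined by its
    components at q = f p. For the internal hom one uses currying: a section u
    of Hom (M, L) over U_p is applied at p itself, and conversely an element n
    of N_p acts on M_q for q >= p through its image in N_q. *)

(** * Composing and transporting adjunctions *)

Section AdjunctionCalculus.
Variable k : fieldType.

Lemma hom_compA d (P : porderType d) (A B C D : pmod k P)
    (w : pm_hom C D) (v : pm_hom B C) (u : pm_hom A B) :
  hom_comp w (hom_comp v u) = hom_comp (hom_comp w v) u.
Proof. exact: hom_ext. Qed.

Lemma hom_comp_idr d (P : porderType d) (A B : pmod k P) (u : pm_hom A B) :
  hom_comp u (hom_id A) = u.
Proof. exact: hom_ext. Qed.

(** The bijections of the two adjunctions are composed, so that the right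
    adjoints get composed in the opposite order. *)
Lemma left_adjoint_comp d (P : porderType d) d' (Q : porderType d')
    d'' (R : porderType d'')
    (F1 : pm_functor k P Q) (G1 : pm_functor k Q P)
    (F2 : pm_functor k Q R) (G2 : pm_functor k R Q) :
  left_adjoint F1 G1 -> left_adjoint F2 G2 ->
  left_adjoint (functor_comp F2 F1) (functor_comp G1 G2).
Proof.
move=> [Phi1 [bij1 nat1]] [Phi2 [bij2 nat2]].
exists (fun N L h => Phi1 N (G2 L) (Phi2 (F1 N) L h)); split=> [N L|].
  exact: (bij_comp (bij1 N (G2 L)) (bij2 (F1 N) L)).
by move=> N N' L L' f g h /=; rewrite nat2 nat1.
Qed.

(** A left adjoint may be replaced by an isomorphic functor: the bijection is
    precomposed with the isomorphism [t]. *)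
Lemma left_adjoint_iso d (P : porderType d) d' (Q : porderType d')
    (F F' : pm_functor k P Q) (G : pm_functor k Q P)
    (s : forall N, pm_hom (F' N) (F N)) (t : forall N, pm_hom (F N) (F' N)) :
  (forall N, hom_comp (s N) (t N) = hom_id (F N)) ->
  (forall N, hom_comp (t N) (s N) = hom_id (F' N)) ->
  (forall N N' (f : pm_hom N' N),
     hom_comp (t N) (fmap F f) = hom_comp (fmap F' f) (t N')) ->
  left_adjoint F G -> left_adjoint F' G.
Proof.
move=> stK tsK t_nat [Phi [bij nat]].
exists (fun N L h => Phi N L (hom_comp h (t N))); split=> [N L|].
  have bij_t : bijective (fun h : pm_hom (F' N) L => hom_comp h (t N)).
    exists (fun h => hom_comp h (s N)) => h.
      by rewrite -hom_compA tsK hom_comp_idr.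
    by rewrite -hom_compA stK hom_comp_idr.
  exact: (bij_comp (bij N L) bij_t).
by move=> N N' L L' f g h; rewrite -nat -!hom_compA -t_nat.
Qed.

End AdjunctionCalculus.

(** * Left Kan extension and inverse image *)

Section CoPushforwardPullback.
Variables (k : fieldType) (d : Order.disp_t) (P : porderType d).
Variables (d' : Order.disp_t) (Q : porderType d') (f : {omorphism P -> Q}).

Section Transpose.
Variables (F : pmod k P) (G : pmod k Q).

Section Down.
Variable h : pm_hom (copushforward f F) G.

(** The value at [p] of the transpose of [h]: the element [p] is itself among
    the indices of the colimit at [f p], which gives the unit
    F_p -> (f_dagger F)_(f p). *)
Definition copush_restrict_fun p (x : F p) : G (f p) :=
  h (f p) (colim_below_in (lexx (f p) : below f (f p) p) x).

Fact copush_restrict_linear p : linear (@copush_restrict_fun p).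
Proof.
by move=> a x y; rewrite /copush_restrict_fun colim_below_in_linear linearP.
Qed.

Fact copush_restrict_nat p q (hpq : (p <= q)%O) (x : F p) :
  mklin (@copush_restrict_linear q) (pm_map F hpq x) =
  pm_map (pullback f G) hpq (mklin (@copush_restrict_linear p) x).
Proof.
rewrite /= /copush_restrict_fun -hom_nat.
have hp : below f (f q) p by exact: omorph_le.
(* Both sides are the class of x in the colimit at f q: on the left through
   index q, on the right through index p. *)
congr (h _ _); rewrite [RHS](copushforward_mapE _ _ hp).
exact: colim_below_in_compat.
Qed.

Definition copush_restrict : pm_hom F (pullback f G) :=
  @PMHom k d P F (pullback f G)
    (fun p => mklin (@copush_restrict_linear p)) copush_restrict_nat.
End Down.

Section Up.
Variable u : pm_hom F (pullback f G).

(** For f p <= q, the only map F_p -> G_q that naturality in q allows. *)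
Definition copush_extend_gen q (p : subposet (below f q)) (x : F (val p)) :
  G q := pm_map G (valP p : (f (val p) <= q)%O) (u (val p) x).

Fact copush_extend_linear q p : linear (@copush_extend_gen q p).
Proof. by move=> a x y; rewrite /copush_extend_gen !linearP. Qed.

Fact copush_extend_compat q (p p' : subposet (below f q)) (hp : (p <= p')%O)
    (x : pullback (incl (below f q)) F p) :
  copush_extend_gen (pm_map (pullback (incl (below f q)) F) hp x) =
  copush_extend_gen x.
Proof. rewrite /copush_extend_gen /= hom_nat; exact/esym/pm_comp. Qed.

Definition copush_extend_at q : {linear copushforward f F q -> G q} :=
  colim_lift (M := pullback (incl (below f q)) F)
    (@copush_extend_linear q) (@copush_extend_compat q).

Lemma copush_extendE q p (hp : below f q p) (x : F p) :
  copush_extend_at q (colim_below_in hp x) =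
  pm_map G (hp : (f p <= q)%O) (u p x).
Proof. by rewrite [LHS]colim_liftE; exact: pm_map_irr. Qed.

Fact copush_extend_nat q q' (h : (q <= q')%O) (x : copushforward f F q) :
  copush_extend_at q' (pm_map (copushforward f F) h x) =
  pm_map G h (copush_extend_at q x).
Proof.
refine (@colim_below_ext k d P d' Q f F q _
  (copush_extend_at q' \o copushforward_map f F h)
  (pm_map G h \o copush_extend_at q) _ x) => p hp y.
have hp' := below_sub h hp.
transitivity (copush_extend_at q' (colim_below_in hp' y)).
  by congr (copush_extend_at q' _); exact: copushforward_mapE.
rewrite copush_extendE [RHS](congr1 (pm_map G h) (copush_extendE hp y)).
exact: pm_comp.
Qed.

Definition copush_extend : pm_hom (copushforward f F) G :=
  PMHom (hom_at := copush_extend_at) copush_extend_nat.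
End Up.

(** A map out of f_dagger F is recovered from its restriction because every
    class at q with index p comes from the class with the same index at f p. *)
Lemma copush_restrictK : cancel copush_restrict copush_extend.
Proof.
move=> h; apply: hom_ext => q; apply: colim_below_ext => p hp x.
rewrite [LHS]copush_extendE [LHS]/= /copush_restrict_fun -hom_nat.
by congr (h q _); exact: copushforward_mapE.
Qed.

Lemma copush_extendK : cancel copush_extend copush_restrict.
Proof.
move=> u; apply: hom_ext => p x; rewrite [LHS]/= /copush_restrict_fun.
by rewrite [LHS]copush_extendE; exact: (pm_id (p := f p)).
Qed.

End Transpose.

Lemma copushforward_pullback_adj :
  left_adjoint (copushforward_functor k f) (pullback_functor k f).
Proof.
exists copush_restrict; split=> [N L|N N' L L' u v h].
  exact: (Bijective (@copush_restrictK N L) (@copush_extendK N L)).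
apply: hom_ext => p x; rewrite /= /copush_restrict_fun /=.
by congr (v _ (h _ _)); exact: copushforward_homE.
Qed.

End CoPushforwardPullback.

(** * Inverse and direct image *)

Section PullbackPushforward.
Variables (k : fieldType) (d : Order.disp_t) (P : porderType d).
Variables (d' : Order.disp_t) (Q : porderType d') (f : {omorphism P -> Q}).

Section Transpose.
Variables (G : pmod k Q) (F : pmod k P).

Section Right.
Variable h : pm_hom (pullback f G) F.

(** The component at [p] of the image of x in G_q in the limit over q <= f p:
    carry x to G_(f p), then apply [h]. *)
Definition push_lift_at q (p : subposet (above f q)) :
  {linear G q -> F (val p)} :=
  h (val p) \o pm_map G (valP p : (q <= f (val p))%O).

Fact push_lift_compat q (p p' : subposet (above f q)) (hp : (p <= p')%O) x :
  pm_map (pullback (incl (above f q)) F) hp (push_lift_at p x) =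
  push_lift_at p' x.
Proof.
apply: (etrans (esym (hom_nat h (omorph_le (incl (above f q)) hp) _))).
congr (h _ _); exact: (esym (pm_comp (p0 := G) _ _ _ x)).
Qed.

Fact push_lift_nat q q' (hq : (q <= q')%O) (x : G q) :
  lim_lift (@push_lift_compat q') (pm_map G hq x) =
  pm_map (pushforward f F) hq (lim_lift (@push_lift_compat q) x).
Proof.
apply: limit_ext => p; congr (h _ _); exact: (esym (pm_comp (p0 := G) _ _ _ x)).
Qed.

Definition push_lift : pm_hom G (pushforward f F) :=
  PMHom (N := pushforward f F)
    (hom_at := fun q => lim_lift (@push_lift_compat q)) push_lift_nat.
End Right.

Section Left.
Variable u : pm_hom G (pushforward f F).

(** The transpose of [u] reads off the component of index [p] in the limit
    at [f p], that is, it composes [u] with the counit (f_* F)_(f p) -> F_p. *)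
Definition push_diag_fun p (x : G (f p)) : F p :=
  (u (f p) x : lim_above f F (f p)) (exist _ p (lexx (f p) : above f (f p) p)).

Fact push_diag_linear p : linear (@push_diag_fun p).
Proof. by move=> a x y; rewrite /push_diag_fun linearP. Qed.

(** The component of [u q x] at [p] depends only on the image of [x] in
    G_(f p); so [u] is determined by its diagonal components. *)
Lemma push_diagE q p (hp : above f q p) (x : G q) :
  push_diag_fun (pm_map G (hp : (q <= f p)%O) x) =
  (u q x : lim_above f F q) (exist _ p hp).
Proof.
rewrite /push_diag_fun hom_nat.
exact: (@lim_above_irr _ _ _ _ _ f F q (u q x) p).
Qed.

Fact push_diag_nat p q (hpq : (p <= q)%O) (x : pullback f G p) :
  mklin (@push_diag_linear q) (pm_map (pullback f G) hpq x) =
  pm_map F hpq (mklin (@push_diag_linear p) x).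
Proof.
pose p0 : subposet (above f (f p)) := exist _ p (lexx (f p) : above f (f p) p).
pose q0 : subposet (above f (f p)) := exist _ q (omorph_le f hpq : above f _ q).
have hpq0 : (p0 <= q0)%O := hpq.
transitivity ((u (f p) x : lim_above f F (f p)) q0).
  exact: (push_diagE (omorph_le f hpq : above f _ q) x).
apply: (etrans (esym (lim_compat (u (f p) x : lim_above f F (f p)) hpq0))).
exact: (pm_map_irr (M := F)).
Qed.

Definition push_diag : pm_hom (pullback f G) F :=
  @PMHom k d P (pullback f G) F
    (fun p => mklin (@push_diag_linear p)) push_diag_nat.
End Left.

Lemma push_liftK : cancel push_lift push_diag.
Proof.
by move=> h; apply: hom_ext => p x; rewrite /= /push_diag_fun /= pm_id.
Qed.

Lemma push_diagK : cancel push_diag push_lift.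
Proof.
move=> u; apply: hom_ext => q x; apply: limit_ext => -[p hp].
rewrite /= (pm_map_irr _ (hp : (q <= f p)%O)); exact: push_diagE.
Qed.

End Transpose.

Lemma pullback_pushforward_adj :
  left_adjoint (pullback_functor k f) (pushforward_functor k f).
Proof.
exists push_lift; split=> [N L|N N' L L' u v h].
  exact: (Bijective (@push_liftK N L) (@push_diagK N L)).
apply: hom_ext => q x; apply: limit_ext => p /=.
by rewrite -hom_nat.
Qed.

End PullbackPushforward.

(** * Pointwise tensor product and sheaf internal hom *)

Section TensorHom.
Variables (k : fieldType) (d : Order.disp_t) (P : porderType d).
Variable M : pmod k P.

Section Transpose.
Variables N L : pmod k P.

Section Curry.
Variable h : pm_hom (ptensor M N) L.

Section At.
Variables (p : P) (n : N p).

(** An element n of N_p acts on M_q, for q >= p, through its image in N_q. *)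
Definition curry_fun (q : subposet (upset p)) (m : M (val q)) : L (val q) :=
  h (val q) (tens m (pm_map N (valP q : (p <= val q)%O) n)).

Fact curry_fun_linear q : linear (@curry_fun q).
Proof. by move=> a m m'; rewrite /curry_fun tens_linear_l linearP. Qed.

Fact curry_fun_nat (q q' : subposet (upset p)) (hq : (q <= q')%O)
    (m : restr M p q) :
  mklin (@curry_fun_linear q') (pm_map (restr M p) hq m) =
  pm_map (restr L p) hq (mklin (@curry_fun_linear q) m).
Proof.
rewrite /= /curry_fun -hom_nat; congr (h _ _).
rewrite [RHS]tensor_mapE; congr (tens _ _).
exact: pm_comp.
Qed.

Definition curry_at : local_hom M L p :=
  @PMHom k _ _ (restr M p) (restr L p)
    (fun q => mklin (@curry_fun_linear q)) curry_fun_nat.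
End At.

Fact curry_at_linear p : linear (@curry_at p).
Proof.
move=> a n n'; apply: hom_ext => q m.
by rewrite hom_linearE /= /curry_fun linearP tens_linear_r linearP.
Qed.

Fact curry_nat p q (hpq : (p <= q)%O) (n : N p) :
  mklin (@curry_at_linear q) (pm_map N hpq n) =
  pm_map (sheaf_hom M L) hpq (mklin (@curry_at_linear p) n).
Proof.
apply: hom_ext => r m; congr (h _ (tens _ _)).
exact/esym/pm_comp.
Qed.

Definition curry : pm_hom N (sheaf_hom M L) :=
  PMHom (N := sheaf_hom M L) (hom_at := fun p => mklin (@curry_at_linear p))
    curry_nat.
End Curry.

Section Uncurry.
Variable u : pm_hom N (sheaf_hom M L).

(** U_p has p as its least element, and a section over U_p can be applied
    to M_p there. *)
Definition uncurry_fun p (m : M p) (n : N p) : L p :=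
  (u p n : local_hom M L p) (exist _ p (lexx p : upset p p)) m.

Fact uncurry_linear_l p n : linear ((@uncurry_fun p)^~ n).
Proof. by move=> a m m'; rewrite /uncurry_fun linearP. Qed.

Fact uncurry_linear_r p m : linear (@uncurry_fun p m).
Proof. by move=> a n n'; rewrite /uncurry_fun linearP. Qed.

Definition uncurry_at p : {linear ptensor M N p -> L p} :=
  tensor_lift (@uncurry_linear_l p) (@uncurry_linear_r p).

(** Restricting [u p n] to U_q amounts to moving [n] to N_q, by naturality of
    [u]; hence the values on the diagonal determine all of [u]. *)
Lemma uncurry_funE p q (hq : upset p q) (m : M q) (n : N p) :
  uncurry_fun m (pm_map N (hq : (p <= q)%O) n) =
  (u p n : local_hom M L p) (exist _ q hq) m.
Proof.
rewrite /uncurry_fun hom_nat.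
exact: (@local_hom_irr _ _ _ M L p (u p n) q).
Qed.

Fact uncurry_nat p q (hpq : (p <= q)%O) (x : ptensor M N p) :
  uncurry_at q (pm_map (ptensor M N) hpq x) = pm_map L hpq (uncurry_at p x).
Proof.
apply: (@tensor_ext _ _ _ _ (uncurry_at q \o pm_map (ptensor M N) hpq)
  (pm_map L hpq \o uncurry_at p)) => m n.
transitivity (uncurry_fun (pm_map M hpq m) (pm_map N hpq n)).
  apply: (etrans (congr1 (uncurry_at q) (tensor_mapE _ _ m n))).
  exact: tensor_liftE.
apply: esym; apply: (etrans (congr1 (pm_map L hpq) (tensor_liftE _ _ m n))).
apply: esym.
(* Both sides now concern the single section [u p n] over U_p, and what is left
   is its naturality from p to q. *)
rewrite (uncurry_funE (hpq : upset p q)) /uncurry_fun.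
pose p0 : subposet (upset p) := exist _ p (lexx p : upset p p).
pose q0 : subposet (upset p) := exist _ q (hpq : upset p q).
have h0 : (p0 <= q0)%O := hpq.
have /= e := hom_nat (u p n : local_hom M L p) h0 m.
by rewrite (pm_map_irr _ (omorph_le (incl (upset p)) h0)) e; exact: pm_map_irr.
Qed.

Definition uncurry : pm_hom (ptensor M N) L :=
  PMHom (hom_at := uncurry_at) uncurry_nat.
End Uncurry.

Lemma curryK : cancel curry uncurry.
Proof.
move=> h; apply: hom_ext => p; apply: tensor_ext => m n.
by rewrite [LHS]tensor_liftE /uncurry_fun /= /curry_fun pm_id.
Qed.

Lemma uncurryK : cancel uncurry curry.
Proof.
move=> u; apply: hom_ext => p n; apply: hom_ext => -[q hq] m.
rewrite /= /curry_fun [LHS]tensor_liftE (pm_map_irr _ (hq : (p <= q)%O)).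
exact: uncurry_funE.
Qed.

End Transpose.

Lemma ptensor_sheaf_hom_adj :
  left_adjoint (ptensor_functor_r M) (sheaf_hom_functor M).
Proof.
exists curry; split=> [N L|N N' L L' u v h].
  exact: (Bijective (@curryK N L) (@uncurryK N L)).
apply: hom_ext => p n; apply: hom_ext => q m.
congr (v _ (h _ _)); apply: (etrans (tensor_mapE _ _ _ _)).
by rewrite hom_nat.
Qed.

End TensorHom.

(** * Symmetry of the pointwise tensor product *)

Section Braiding.
Variables (k : fieldType).

Section Swap.
Variables V W : lmodType k.

Definition tensor_swap : {linear tensor V W -> tensor W V} :=
  tensor_lift (b := fun v w => tens w v)
    (fun w => tens_linear_r w) (fun v => tens_linear_l v).

Lemma tensor_swapE v w : tensor_swap (tens v w) = tens w v.
Proof. exact: tensor_liftE. Qed.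

End Swap.

Variables (d : Order.disp_t) (P : porderType d).

Section Hom.
Variables M N : pmod k P.

Fact ptensor_swap_nat p q (h : (p <= q)%O) (x : ptensor M N p) :
  tensor_swap (M q) (N q) (pm_map (ptensor M N) h x) =
  pm_map (ptensor N M) h (tensor_swap (M p) (N p) x).
Proof.
apply: (@tensor_ext _ _ _ _ (tensor_swap (M q) (N q) \o pm_map (ptensor M N) h)
  (pm_map (ptensor N M) h \o tensor_swap (M p) (N p))) => m n.
change (tensor_swap (M q) (N q)
    (tensor_map (pm_map M h) (pm_map N h) (tens m n)) =
  tensor_map (pm_map N h) (pm_map M h) (tensor_swap (M p) (N p) (tens m n))).
by rewrite tensor_mapE !tensor_swapE tensor_mapE.
Qed.

Definition ptensor_swap : pm_hom (ptensor M N) (ptensor N M) :=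
  @PMHom k d P (ptensor M N) (ptensor N M)
    (fun p => tensor_swap (M p) (N p)) ptensor_swap_nat.

End Hom.

Lemma ptensor_swapK (M N : pmod k P) :
  hom_comp (ptensor_swap N M) (ptensor_swap M N) = hom_id (ptensor M N).
Proof.
apply: hom_ext => p; apply: tensor_ext => m n.
change (tensor_swap (N p) (M p) (tensor_swap (M p) (N p) (tens m n)) =
  tens m n).
by rewrite !tensor_swapE.
Qed.

Lemma ptensor_sheaf_hom_adj_l (M : pmod k P) :
  left_adjoint (ptensor_functor_l M) (sheaf_hom_functor M).
Proof.
refine (@left_adjoint_iso k d P d P (ptensor_functor_r M) (ptensor_functor_l M)
  _ (fun N => ptensor_swap N M) (fun N => ptensor_swap M N) _ _ _
  (ptensor_sheaf_hom_adj M)).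
- by move=> N; exact: ptensor_swapK.
- by move=> N; exact: ptensor_swapK.
- move=> N N' f; apply: hom_ext => p; apply: tensor_ext => m n.
  change (tensor_swap (M p) (N p) (tensor_map (hom_id M p) (f p) (tens m n)) =
    tensor_map (f p) (hom_id M p) (tensor_swap (M p) (N' p) (tens m n))).
  by rewrite tensor_mapE !tensor_swapE tensor_mapE.
Qed.

End Braiding.

(** * The adjunctions for the phi-tensor product *)

Theorem theorem4p7 (k : fieldType) (d : Order.disp_t) (P : porderType d)
    (phi : {omorphism P *p P -> P}) (M : pmod k P) :
  left_adjoint (phi_tensor_functor_r phi M) (phi_homr_functor phi M) /\
  left_adjoint (phi_tensor_functor_l phi M) (phi_homl_functor phi M).
Proof.
split.
  (* The composites below and those of the statement associate differently;
     their values on modules and morphisms agree by computation. *)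
  exact: (left_adjoint_comp
    (left_adjoint_comp (pullback_pushforward_adj k (pr2 P))
      (ptensor_sheaf_hom_adj (pullback (pr1 P) M)))
    (copushforward_pullback_adj k phi)).
exact: (left_adjoint_comp
  (left_adjoint_comp (pullback_pushforward_adj k (pr1 P))
    (ptensor_sheaf_hom_adj_l (pullback (pr2 P) M)))
  (copushforward_pullback_adj k phi)).
Qed.
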